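(* Let $\mathbf{k}$ be a commutative ring with unit, $X$ a set and $\Omega$ a semigroup. Let $\mathrm{DT}(X,\Omega)$ be the $\mathbf{k}$-module spanned by the $X$-valently decorated $\Omega$-typed Schröder trees with at least two leaves, with the operations $\prec_\omega,\succ_\omega$ ($\omega\in\Omega$) and $\cdot$ defined recursively in the context, and let $j:X\to\mathrm{DT}(X,\Omega)$, $j(x)=\bigvee_{x}^{2;\,1,1}(|,|)$. Then $(\mathrm{DT}(X,\Omega),\{\prec_\omega,\succ_\omega\mid\omega\in\Omega\},\cdot)$, together with the map $j$, is the free tridendriform family algebra on $X$; that is, it is a tridendriform family algebra, and for any tridendriform family algebra $(T',\{\prec'_\omega,\succ'_\omega\mid\omega\in\Omega\},\cdot')$ and any map $f:X\to T'$ there is a unique tridendriform family algebra morphism $\bar f:\mathrm{DT}(X,\Omega)\to T'$ such that $f=\bar f\circ j$.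
   Context: All binary operations on $\mathbf{k}$-modules are $\mathbf{k}$-bilinear. Tridendriform family algebra: a $\mathbf{k}$-module $T$ with binary operations $\{\prec_\omega,\succ_\omega\mid\omega\in\Omega\}$ and a binary operation $\cdot$ such that for all $x,y,z\in T$ and $\alpha,\beta\in\Omega$: $(x\prec_\alpha y)\prec_\beta z=x\prec_{\alpha\beta}(y\prec_\beta z+y\succ_\alpha z+y\cdot z)$; $(x\succ_\alpha y)\prec_\beta z=x\succ_\alpha(y\prec_\beta z)$; $(x\prec_\beta y+x\succ_\alpha y+x\cdot y)\succ_{\alpha\beta}z=x\succ_\alpha(y\succ_\beta z)$; $(x\succ_\alpha y)\cdot z=x\succ_\alpha(y\cdot z)$; $(x\prec_\alpha y)\cdot z=x\cdot(y\succ_\alpha z)$; $(x\cdot y)\prec_\alpha z=x\cdot(y\prec_\alpha z)$; $(x\cdot y)\cdot z=x\cdot(y\cdot z)$. A morphism of tridendriform family algebras is a $\mathbf{k}$-linear map commuting with all $\prec_\omega,\succ_\omega$ and with $\cdot$. Monoid $\Omega^1$: if $\Omega$ has no identity element, $\Omega^1:=\Omega\sqcup\{1\}$ with $1\omega=\omega1=\omega$ and $11=1$; if $\Omega$ has an identity, $\Omega^1:=\Omega$ and $1$ denotes its identity. Trees: a Schröder tree is a reduced planar rooted tree (every internal vertex has at least two incoming edges; its arity is the number of incoming edges). For $n\ge0$, $T_n$ is the set of Schröder trees with $n+1$ leaves in which every internal vertex of arity $k+1$ is decorated by an element of $X^k$, every internal edge (edge joining two internal vertices; neither a leaf nor the root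 edge) is decorated by an element of $\Omega$, and leaves are decorated by $1\in\Omega^1$. $T_0=\{|\}$, where $|$ has one leaf and no internal vertex. For trees $T^{(0)},\dots,T^{(k)}$ ($k\ge1$), $x_1,\dots,x_k\in X$ and $\alpha_0,\dots,\alpha_k\in\Omega^1$ (with $\alpha_i=1$ if $T^{(i)}=|$ and $\alpha_i\in\Omega$ otherwise), the grafting $\bigvee_{x_1,\dots,x_k}^{k+1;\,\alpha_0,\dots,\alpha_k}(T^{(0)},\dots,T^{(k)})$ is the tree obtained by joining the roots of $T^{(0)},\dots,T^{(k)}$, from left to right, to a new vertex decorated by $(x_1,\dots,x_k)$, the new edges being decorated from left to right by $\alpha_0,\dots,\alpha_k$. Every tree other than $|$ is uniquely such a grafting. The depth $\mathrm{dep}(T)$ is the maximal number of internal vertices on a path from the root to a leaf ($\mathrm{dep}(|)=0$). Grafting is extended multilinearly. $\mathrm{DT}(X,\Omega):=\bigoplus_{n\ge1}\mathbf{k}T_n$. The bilinear operations $\prec_\omega,\succ_\omega$ ($\omega\in\Omega$) and $\cdot$ are defined recursively on $\mathrm{dep}(T)+\mathrm{dep}(U)$ by: (a) for $\omega\in\Omega$ and $T\in T_n$ with $n\ge1$: $|\succ_\omega T:=T\prec_\omega|:=T$, $|\prec_\omega T:=T\succ_\omega|:=0$ and $|\cdot T:=T\cdot|:=0$; likewise for $\omega=1\in\Omega^1$: $|\succ_1T:=T\prec_1|:=T$, $|\prec_1T:=T\succ_1|:=0$; moreover $|\prec_1|+|\succ_1|+|\cdot|:=|$; (b) for $T=\bigvee_{x_1,\dots,x_m}^{m+1;\,\alpha_0,\dots,\alpha_m}(T^{(0)},\dots,T^{(m)})$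 and $U=\bigvee_{y_1,\dots,y_n}^{n+1;\,\beta_0,\dots,\beta_n}(U^{(0)},\dots,U^{(n)})$: $$T\prec_\omega U:=\bigvee\nolimits_{x_1,\dots,x_m}^{m+1;\,\alpha_0,\dots,\alpha_{m-1},\alpha_m\omega}\bigl(T^{(0)},\dots,T^{(m-1)},\,T^{(m)}\succ_{\alpha_m}U+T^{(m)}\prec_\omega U+T^{(m)}\cdot U\bigr),$$ $$T\succ_\omega U:=\bigvee\nolimits_{y_1,\dots,y_n}^{n+1;\,\omega\beta_0,\beta_1,\dots,\beta_n}\bigl(T\succ_\omega U^{(0)}+T\prec_{\beta_0}U^{(0)}+T\cdot U^{(0)},\,U^{(1)},\dots,U^{(n)}\bigr),$$ $$T\cdot U:=\bigvee\nolimits_{x_1,\dots,x_m,y_1,\dots,y_n}^{m+n+1;\,\alpha_0,\dots,\alpha_{m-1},\alpha_m\beta_0,\beta_1,\dots,\beta_n}\bigl(T^{(0)},\dots,T^{(m-1)},\,T^{(m)}\succ_{\alpha_m}U^{(0)}+T^{(m)}\prec_{\beta_0}U^{(0)}+T^{(m)}\cdot U^{(0)},\,U^{(1)},\dots,U^{(n)}\bigr).$$ *)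

(* Defs.v *)
From HB Require Import structures.
From mathcomp Require Import all_boot all_order all_algebra finmap.
From mathcomp Require Import boolp.
From mathcomp.multinomials Require Import monalg.

Set Implicit Arguments.
Unset Strict Implicit.
Unset Printing Implicit Defensive.

Import GRing.Theory.
Local Open Scope ring_scope.

(* The free k-module on A.  The scaling that [monalg] puts on {malg k[A]}
   excludes the zero ring, so it is defined again on an alias. *)
Definition freemod (k : pzRingType) (A : choiceType) : Type := {malg k[A]}.

HB.instance Definition _ (k : pzRingType) (A : choiceType) :=
  GRing.Zmodule.on (freemod k A).

Section FreeModule.
Variables (k : pzRingType) (A : choiceType).

Definition fm_scale (c : k) (u : freemod k A) : freemod k A :=
  [malg a in msupp u => c * u@_a].

Fact fm_scaleE c (u : freemod k A) a : (fm_scale c u)@_a = c * u@_a.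
Proof. by rewrite mcoeffE; case: msuppP; rewrite ?mulr0. Qed.

Fact fm_scaleA c d u : fm_scale c (fm_scale d u) = fm_scale (c * d) u.
Proof. by apply/malgP=> a; rewrite !fm_scaleE mulrA. Qed.

Fact fm_scale1 : left_id 1 fm_scale.
Proof. by move=> u; apply/malgP=> a; rewrite fm_scaleE mul1r. Qed.

Fact fm_scaleDr : right_distributive fm_scale +%R.
Proof.
move=> c u v; apply/malgP=> a.
by rewrite !(fm_scaleE, mcoeffD) mulrDr.
Qed.

Fact fm_scaleDl u : {morph fm_scale^~ u : c d / c + d}.
Proof.
move=> c d; apply/malgP=> a.
by rewrite !(fm_scaleE, mcoeffD) mulrDl.
Qed.

HB.instance Definition _ := GRing.Zmodule_isLmodule.Build k (freemod k A)
  fm_scaleA fm_scale1 fm_scaleDr fm_scaleDl.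

End FreeModule.

Section LinearExtension.
Variables (k : pzRingType) (A B : choiceType).

Definition fm_basis (a : A) : freemod k A := << a >>.

Definition lin_ext (f : A -> freemod k B) (u : freemod k A) : freemod k B :=
  \sum_(a <- msupp u) u@_a *: f a.

Definition bilin_ext (f : A -> A -> freemod k B) (u v : freemod k A) :
    freemod k B :=
  \sum_(a <- msupp u) \sum_(b <- msupp v) (u@_a * v@_b) *: f a b.

End LinearExtension.

Section Trees.
Variables (X Omega : Type).

(* [stree] is the type of the X-valently decorated Omega-typed Schroeder trees
   other than |, i.e. the union of the T_n for n >= 1, and a [branch] is a tree
   (possibly |) together with the edge that attaches it to its parent vertex:
     [Leaf]      is | with its edge, which is always decorated by 1, so that
                 the decoration is not stored;
     [Edge a T]  is T <> | attached by an internal edge decorated by a.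
   An element 1 of Omega, if Omega has an identity, can also occur as [Edge 1 T].

   [Vertex T0 [:: (x_1, T1); ...; (x_(m-1), T(m-1))] x_m Tm] is the grafting of
   the branches T0, ..., Tm (m >= 1) to a vertex of arity m+1 decorated by
   (x_1, ..., x_m): the decoration x_i is read between T(i-1) and Ti.  The last
   pair is kept apart so that m >= 1 holds by construction, and the first and
   the last branches are immediate subterms. *)
Inductive stree : Type :=
  Vertex of branch & seq (X * branch) & X & branch
with branch : Type :=
  Leaf | Edge of Omega & stree.

HB.instance Definition _ := gen_eqMixin stree.
HB.instance Definition _ := gen_choiceMixin stree.
HB.instance Definition _ := gen_eqMixin branch.
HB.instance Definition _ := gen_choiceMixin branch.

End Trees.

Arguments Leaf {X Omega}.

Section Operations.
Variables (k : comPzRingType) (X : Type) (Omega : semigroupType).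

Local Notation stree := (stree X Omega).
Local Notation branch := (branch X Omega).

Definition DT : Type := freemod k stree.
HB.instance Definition _ := GRing.Lmodule.on DT.

(* Multilinear extension of grafting, in the last and in the first branch. *)
Definition graft_last (T0 : branch) (s : seq (X * branch)) (x : X)
    (u : freemod k branch) : DT :=
  lin_ext (fun b => fm_basis k (Vertex T0 s x b)) u.

Definition graft_first (u : freemod k branch) (s : seq (X * branch)) (x : X)
    (Tk : branch) : DT :=
  lin_ext (fun b => fm_basis k (Vertex b s x Tk)) u.

Definition graft_mid (T0 : branch) (s : seq (X * branch)) (x : X)
    (u : freemod k branch) (s' : seq (X * branch)) (y : X) (Tk : branch) : DT :=
  lin_ext (fun b => fm_basis k (Vertex T0 (s ++ (x, b) :: s') y Tk)) u.

Variant tree_op : Type := Prec of Omega | Succ of Omega | Dot.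

Definition edge_join (a b : Omega) (F : tree_op -> DT) : freemod k branch :=
  lin_ext (fun V => fm_basis k (Edge (a * b)%g V))
    (F (Succ a) + F (Prec b) + F Dot).

(* The three operations on trees, by structural recursion on both of them.
   The [match]es on branches are instances of [branch_join] below. *)
Fixpoint tree_ops (T : stree) : stree -> tree_op -> DT :=
  fix tree_ops_T (U : stree) (o : tree_op) : DT :=
    let: Vertex T0 s x Tm := T in
    let: Vertex U0 s' y Un := U in
    match o with
    | Prec w =>
        graft_last T0 s x
          (match Tm with
           | Leaf => fm_basis k (Edge w U)
           | Edge a T' => edge_join a w (tree_ops T' U)
           end)
    | Succ w =>
        graft_first
          (match U0 with
           | Leaf => fm_basis k (Edge w T)
           | Edge b U' => edge_join w b (tree_ops_T U')
           end) s' y Un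
    | Dot =>
        graft_mid T0 s x
          (match Tm, U0 with
           | Leaf, _ => fm_basis k U0
           | _, Leaf => fm_basis k Tm
           | Edge a T', Edge b U' => edge_join a b (tree_ops T' U')
           end) s' y Un
    end.

(* For branches (a, T) and (b, U), with a, b in Omega^1, this is the sum
   T >_a U + T <_b U + T . U, attached by an edge decorated by ab.  The rules
   for | give U if T = |, T if U = |, and | if T = U = |, while a = 1 if T = |
   and b = 1 if U = |; so the label ab is in all cases obtained without
   reference to Omega^1. *)
Definition branch_join (B C : branch) : freemod k branch :=
  match B, C with
  | Leaf, _ => fm_basis k C
  | _, Leaf => fm_basis k B
  | Edge a T, Edge b U => edge_join a b (tree_ops T U)
  end.

Fact tree_ops_PrecE w T0 s x Tm (U : stree) :
  tree_ops (Vertex T0 s x Tm) U (Prec w) =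
    graft_last T0 s x (branch_join Tm (Edge w U)).
Proof. by case: U Tm => [? ? ? ?] []. Qed.

Fact tree_ops_SuccE w (T : stree) U0 s y Un :
  tree_ops T (Vertex U0 s y Un) (Succ w) =
    graft_first (branch_join (Edge w T) U0) s y Un.
Proof. by case: T U0 => [? ? ? ?] []. Qed.

Fact tree_ops_DotE T0 s x Tm U0 s' y Un :
  tree_ops (Vertex T0 s x Tm) (Vertex U0 s' y Un) Dot =
    graft_mid T0 s x (branch_join Tm U0) s' y Un.
Proof. by []. Qed.

Definition dt_prec (w : Omega) : DT -> DT -> DT :=
  bilin_ext (fun T U => tree_ops T U (Prec w)).

Definition dt_succ (w : Omega) : DT -> DT -> DT :=
  bilin_ext (fun T U => tree_ops T U (Succ w)).

Definition dt_dot : DT -> DT -> DT :=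
  bilin_ext (fun T U => tree_ops T U Dot).

Definition dt_j (x : X) : DT := fm_basis k (Vertex Leaf [::] x Leaf).

End Operations.

Section TridendriformFamily.
Variables (k : comPzRingType) (Omega : semigroupType).

Definition bilinear_op (T : lmodType k) (op : T -> T -> T) : Prop :=
  (forall y, linear (fun x => op x y)) /\ (forall x, linear (op x)).

Record is_tridendriform_family (T : lmodType k)
    (prec succ : Omega -> T -> T -> T) (dot : T -> T -> T) : Prop := {
  tdf_prec_bilinear : forall a, bilinear_op (prec a);
  tdf_succ_bilinear : forall a, bilinear_op (succ a);
  tdf_dot_bilinear : bilinear_op dot;
  tdf_prec_prec : forall a b x y z,
    prec b (prec a x y) z
    = prec (a * b)%g x (prec b y z + succ a y z + dot y z);
  tdf_succ_prec : forall a b x y z,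
    prec b (succ a x y) z = succ a x (prec b y z);
  tdf_succ_succ : forall a b x y z,
    succ (a * b)%g (prec b x y + succ a x y + dot x y) z
    = succ a x (succ b y z);
  tdf_succ_dot : forall a x y z, dot (succ a x y) z = succ a x (dot y z);
  tdf_prec_dot : forall a x y z, dot (prec a x y) z = dot x (succ a y z);
  tdf_dot_prec : forall a x y z, prec a (dot x y) z = dot x (prec a y z);
  tdf_dot_dot : forall x y z, dot (dot x y) z = dot x (dot y z)
}.

Record is_tridendriform_morphism (T T' : lmodType k)
    (prec succ : Omega -> T -> T -> T) (dot : T -> T -> T)
    (prec' succ' : Omega -> T' -> T' -> T') (dot' : T' -> T' -> T')
    (g : T -> T') : Prop := {
  tdm_linear : linear g;
  tdm_prec : forall a x y, g (prec a x y) = prec' a (g x) (g y);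
  tdm_succ : forall a x y, g (succ a x y) = succ' a (g x) (g y);
  tdm_dot : forall x y, g (dot x y) = dot' (g x) (g y)
}.

End TridendriformFamily.

(* Main.v *)
(** The free module on the branches, with the bilinear extension [bjoin] of
    [branch_join], is a unital semigroup: expanded on vertices, each
    tridendriform identity either says that operations on the first and on the
    last branch of the middle tree commute, or is the associativity of [bjoin] on three
    branches of smaller total size; conversely, associativity on three edges is
    the sum of the seven identities for the trees they carry.

    In any tridendriform family algebra a branch acts on the left by [succ] and
    on the right by [prec]; both are actions of that semigroup, balanced with
    respect to the dot.  A vertex with branches B0, ..., Bm must be sent to
      B0 acting on  (f x1 B1) . (f x2 B2) . ... . (f xm Bm),
    which determines the morphism, and the actions show that it is one. *)

Require Import Defs.
From mathcomp Require Import all_boot all_algebra finmap.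
From mathcomp Require Import boolp zify.
From mathcomp.multinomials Require Import monalg.

Set Implicit Arguments.
Unset Strict Implicit.
Unset Printing Implicit Defensive.

Import GRing.Theory.
Local Open Scope ring_scope.

(** * Linear maps between modules, as plain functions *)

Section LinearMaps.
Variables (k : comPzRingType) (U V W : lmodType k).

Lemma lin0 (f : U -> V) : linear f -> f 0 = 0.
(* Linearity at the scalar -1 gives f 0 = - f 0 + f 0 = 0. *)
Proof. by move=> lf; have := lf (-1) 0 0; rewrite !scaleN1r !addNr. Qed.

Lemma linD (f : U -> V) : linear f -> {morph f : u v / u + v}.
Proof. by move=> lf u v; have := lf 1 u v; rewrite !scale1r. Qed.

Lemma lin_comp (g : V -> W) (f : U -> V) :
  linear g -> linear f -> linear (fun u => g (f u)).
Proof. by move=> lg lf c u v; rewrite lf lg. Qed.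

Lemma lin_add (f g : U -> V) :
  linear f -> linear g -> linear (fun u => f u + g u).
Proof. by move=> lf lg c u v; rewrite lf lg scalerDr addrACA. Qed.

End LinearMaps.

(** * Linear extension of a map given on a basis *)

Section Lext.
Variables (k : comPzRingType) (A : choiceType) (M : lmodType k).
Implicit Types (f : A -> M) (u v : freemod k A).

(** The sum in [lin_ext], with values in any module so that evaluation is covered too. For a free
    target the two are convertible, so that [graft_last], [graft_first] and [graft_mid] are
    instances. *)
Definition lext f u : M := \sum_(a <- msupp u) u@_a *: f a.

Lemma lextEw f u (S : {fset A}) : (msupp u `<=` S)%fset ->
  lext f u = \sum_(a <- S) u@_a *: f a.
Proof.
move=> sS; apply: big_fset_incl => // a _ /mcoeff_outdom ->.
by rewrite scale0r.
Qed.

Lemma lext_linear f : linear (lext f).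
Proof.
move=> c u v; have cE a : (c *: u + v)@_a = c * u@_a + v@_a.
  by rewrite mcoeffD; congr (_ + _); apply: fm_scaleE.
(* The three supports differ; all three sums are taken over this common set. *)
pose S := (msupp u `|` msupp v)%fset.
rewrite (@lextEw f _ S) ?(@lextEw f u S) ?(@lextEw f v S);
  rewrite ?fsubsetUl ?fsubsetUr//.
  rewrite scaler_sumr -big_split; apply: eq_bigr => a _.
  by rewrite cE scalerDl scalerA.
apply/fsubsetP=> a; rewrite in_fsetU -!mcoeff_neq0 cE.
apply: contraNT; rewrite negb_or !negbK => /andP[/eqP-> /eqP->].
by rewrite mulr0 addr0.
Qed.

Lemma lext_basis f a : lext f (fm_basis k a) = f a.
Proof.
rewrite (@lextEw f _ [fset a]%fset) ?msuppU_le//.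
by rewrite big_seq_fset1 mcoeffUU scale1r.
Qed.

Lemma eq_lext f g u : f =1 g -> lext f u = lext g u.
Proof. by move=> fg; apply: eq_bigr => a _; rewrite fg. Qed.

Lemma fm_basisE u :
  u = \sum_(a <- msupp u) u@_a *: (fm_basis k a : freemod k A).
Proof.
rewrite [LHS]monalgE; apply: eq_bigr => a _; apply/malgP => b.
by rewrite [RHS]fm_scaleE !mcoeffU mulrnAr mulr1.
Qed.

Lemma lin_sum (I : Type) (r : seq I) (N : lmodType k) (g : M -> N)
    (c : I -> k) (F : I -> M) : linear g ->
  g (\sum_(i <- r) c i *: F i) = \sum_(i <- r) c i *: g (F i).
Proof.
move=> lg; elim: r => [|i r IH]; first by rewrite !big_nil lin0.
by rewrite !big_cons lg IH.
Qed.

End Lext.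

Lemma lin_lext (k : comPzRingType) (A : choiceType) (M N : lmodType k)
    (g : M -> N) (f : A -> M) (u : freemod k A) : linear g ->
  g (lext f u) = lext (fun a => g (f a)) u.
Proof. exact: lin_sum. Qed.

Lemma lin_ext_eq (k : comPzRingType) (A : choiceType) (M : lmodType k)
    (f g : freemod k A -> M) : linear f -> linear g ->
  (forall a, f (fm_basis k a) = g (fm_basis k a)) -> f =1 g.
Proof.
move=> lf lg fg u; rewrite (fm_basisE u) !lin_sum //.
by apply: eq_bigr => a _; rewrite fg.
Qed.

(** Finite sums are swapped, and commutativity of [k] matches the coefficients. The identities in
    which two graftings act on different branches reduce to this. *)
Lemma lext_exchange (k : comPzRingType) (A B : choiceType) (M : lmodType k)
    (F : A -> B -> M) (u : freemod k A) (v : freemod k B) :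
  lext (fun a => lext (F a) v) u = lext (fun b => lext (F^~ b) u) v.
Proof.
have scal (C : choiceType) (G : C -> M) (w : freemod k C) c :
    c *: lext G w = \sum_(a <- msupp w) (c * w@_a) *: G a.
  by rewrite scaler_sumr; apply: eq_bigr => a _; rewrite scalerA.
rewrite /lext; under eq_bigr do rewrite scal.
rewrite exchange_big /=; apply: eq_bigr => b _; rewrite scal.
by apply: eq_bigr => a _; rewrite mulrC.
Qed.

(** * Bilinear extension as an iterated linear extension *)

Section Bilext.
Variables (k : comPzRingType) (A B : choiceType).
Variable f : A -> A -> freemod k B.

Lemma bilin_extE u v : bilin_ext f u v = lext (fun a => lext (f a) v) u.
Proof.
apply: eq_bigr => a _; rewrite scaler_sumr.
by apply: eq_bigr => b _; rewrite scalerA.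
Qed.

Lemma bilin_ext_linearl v : linear (bilin_ext f ^~ v).
Proof. by move=> c u w; rewrite !bilin_extE lext_linear. Qed.

Lemma bilin_ext_linearr u : linear (bilin_ext f u).
Proof. by move=> c v w; rewrite !bilin_extE !(lext_exchange f) lext_linear. Qed.

Lemma bilin_ext_basis a b : bilin_ext f (fm_basis k a) (fm_basis k b) = f a b.
Proof. by rewrite bilin_extE !lext_basis. Qed.

End Bilext.

(** * The operations on trees and the product of branches *)

Section Trees.
Variables (k : comPzRingType) (X : Type) (Omega : semigroupType).

Local Notation stree := (stree X Omega).
Local Notation branch := (branch X Omega).
Local Notation DT := (DT k X Omega).
Local Notation FB := (freemod k branch).
Local Notation bs := (fm_basis k).
Local Notation prec := (@dt_prec k X Omega).
Local Notation succ := (@dt_succ k X Omega).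
Local Notation dot := (@dt_dot k X Omega).

Implicit Types (T U V : stree) (B C D : branch) (a b : Omega) (x y z : X).
Implicit Types (s : seq (X * branch)).

Definition edge a : DT -> FB := lext (fun V => bs (Edge a V)).

Definition bjoin : FB -> FB -> FB := bilin_ext (@branch_join k X Omega).

Lemma edge_linear a : linear (edge a).
Proof. exact: lext_linear. Qed.

Lemma edge_basis a V : edge a (bs V) = bs (Edge a V).
Proof. exact: lext_basis. Qed.

Lemma bjoin_linearl v : linear (bjoin^~ v).
Proof. exact: bilin_ext_linearl. Qed.

Lemma bjoin_linearr u : linear (bjoin u).
Proof. exact: bilin_ext_linearr. Qed.

Lemma bjoin_basis B C : bjoin (bs B) (bs C) = branch_join k B C.
Proof. exact: bilin_ext_basis. Qed.

Lemma bjoin_leafl u : bjoin (bs Leaf) u = u.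
Proof.
apply: (lin_ext_eq (bjoin_linearr _) (g := id)) => // B.
by rewrite bjoin_basis.
Qed.

Lemma bjoin_leafr u : bjoin u (bs Leaf) = u.
Proof.
apply: (lin_ext_eq (bjoin_linearl _) (g := id)) => // B.
by rewrite bjoin_basis; case: B.
Qed.

Lemma prec_linearl w v : linear (prec w ^~ v).
Proof. exact: bilin_ext_linearl. Qed.

Lemma prec_linearr w u : linear (prec w u).
Proof. exact: bilin_ext_linearr. Qed.

Lemma succ_linearl w v : linear (succ w ^~ v).
Proof. exact: bilin_ext_linearl. Qed.

Lemma succ_linearr w u : linear (succ w u).
Proof. exact: bilin_ext_linearr. Qed.

Lemma dot_linearl v : linear (dot^~ v).
Proof. exact: bilin_ext_linearl. Qed.

Lemma dot_linearr u : linear (dot u).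
Proof. exact: bilin_ext_linearr. Qed.

(** The three-term sum of the first and third axioms; by [bjoin_edge] it is what two joined edges
    carry. *)
Definition dt_sum a b (u v : DT) : DT := prec b u v + succ a u v + dot u v.

Lemma dt_sum_linearl a b v : linear (dt_sum a b ^~ v).
Proof.
by do 2?apply: lin_add;
  [exact: prec_linearl|exact: succ_linearl|exact: dot_linearl].
Qed.

Lemma dt_sum_linearr a b u : linear (dt_sum a b u).
Proof.
by do 2?apply: lin_add;
  [exact: prec_linearr|exact: succ_linearr|exact: dot_linearr].
Qed.

Lemma bjoin_edge a b (u v : DT) :
  bjoin (edge a u) (edge b v) = edge (a * b)%g (dt_sum a b u v).
Proof.
apply: (lin_ext_eq (f := fun u => bjoin (edge a u) (edge b v))
  (g := fun u => edge (a * b)%g (dt_sum a b u v))) => {u}[||T].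
- exact: lin_comp (bjoin_linearl _) (edge_linear _).
- exact: lin_comp (edge_linear _) (dt_sum_linearl _ _ _).
apply: (lin_ext_eq (f := fun v => bjoin (edge a (bs T)) (edge b v))
  (g := fun v => edge (a * b)%g (dt_sum a b (bs T) v))) => {v}[||U].
- exact: lin_comp (bjoin_linearr _) (edge_linear _).
- exact: lin_comp (edge_linear _) (dt_sum_linearr _ _ _).
rewrite !edge_basis bjoin_basis /dt_sum (addrC (prec _ _ _)).
by rewrite /dt_succ /dt_prec /dt_dot !bilin_ext_basis.
Qed.

(** * The operations on grafted trees *)

Lemma graft_last_linear B0 s x : linear (@graft_last k X Omega B0 s x).
Proof. exact: lext_linear. Qed.

Lemma graft_first_linear s x Bm :
  linear (fun u => @graft_first k X Omega u s x Bm).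
Proof. exact: lext_linear. Qed.

Lemma graft_mid_linear B0 s x s' y Cn :
  linear (fun u => @graft_mid k X Omega B0 s x u s' y Cn).
Proof. exact: lext_linear. Qed.

Lemma graft_last_basis B0 s x B :
  graft_last B0 s x (bs B) = bs (Vertex B0 s x B).
Proof. exact: lext_basis. Qed.

Lemma graft_first_basis s x Bm B :
  graft_first (bs B) s x Bm = bs (Vertex B s x Bm).
Proof. exact: lext_basis. Qed.

Lemma graft_mid_basis B0 s x s' y Cn B :
  graft_mid B0 s x (bs B) s' y Cn = bs (Vertex B0 (s ++ (x, B) :: s') y Cn).
Proof. exact: lext_basis. Qed.

(** The recursive rule for [prec], with the last branch and the right argument replaced by linear
    combinations, so that it can be applied again to a result of an operation. The next two lemmas
    do the same for [succ] and [dot]. *)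
Lemma prec_graft_last w B0 s x (u : FB) (v : DT) :
  prec w (graft_last B0 s x u) v = graft_last B0 s x (bjoin u (edge w v)).
Proof.
apply: (lin_ext_eq (f := fun v => prec w (graft_last B0 s x u) v)
  (g := fun v => graft_last B0 s x (bjoin u (edge w v)))) => {v}[||U].
- exact: prec_linearr.
- apply: lin_comp (graft_last_linear _ _ _) _.
  exact: lin_comp (bjoin_linearr _) (edge_linear _).
apply: (lin_ext_eq (f := fun u => prec w (graft_last B0 s x u) (bs U))
  (g := fun u => graft_last B0 s x (bjoin u (edge w (bs U))))) => {u}[||B].
- exact: lin_comp (prec_linearl _ _) (graft_last_linear _ _ _).
- exact: lin_comp (graft_last_linear _ _ _) (bjoin_linearl _).
rewrite graft_last_basis edge_basis bjoin_basis -tree_ops_PrecE.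
exact: bilin_ext_basis.
Qed.

Lemma succ_graft_first w (u : DT) (v : FB) s y Cn :
  succ w u (graft_first v s y Cn) = graft_first (bjoin (edge w u) v) s y Cn.
Proof.
apply: (lin_ext_eq (f := fun u => succ w u (graft_first v s y Cn))
  (g := fun u => graft_first (bjoin (edge w u) v) s y Cn)) => {u}[||T].
- exact: succ_linearl.
- apply: lin_comp (graft_first_linear _ _ _) _.
  exact: lin_comp (bjoin_linearl _) (edge_linear _).
apply: (lin_ext_eq (f := fun v => succ w (bs T) (graft_first v s y Cn))
  (g := fun v => graft_first (bjoin (edge w (bs T)) v) s y Cn)) => {v}[||B].
- exact: lin_comp (succ_linearr _ _) (graft_first_linear _ _ _).
- exact: lin_comp (graft_first_linear _ _ _) (bjoin_linearr _).
rewrite graft_first_basis edge_basis bjoin_basis -tree_ops_SuccE.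
exact: bilin_ext_basis.
Qed.

Lemma dot_graft B0 s x (u v : FB) s' y Cn :
  dot (graft_last B0 s x u) (graft_first v s' y Cn)
  = graft_mid B0 s x (bjoin u v) s' y Cn.
Proof.
apply: (lin_ext_eq
  (f := fun u => dot (graft_last B0 s x u) (graft_first v s' y Cn))
  (g := fun u => graft_mid B0 s x (bjoin u v) s' y Cn)) => {u}[||B].
- exact: lin_comp (dot_linearl _) (graft_last_linear _ _ _).
- exact: lin_comp (graft_mid_linear _ _ _ _ _ _) (bjoin_linearl _).
apply: (lin_ext_eq
  (f := fun v => dot (graft_last B0 s x (bs B)) (graft_first v s' y Cn))
  (g := fun v => graft_mid B0 s x (bjoin (bs B) v) s' y Cn)) => {v}[||C].
- exact: lin_comp (dot_linearr _) (graft_first_linear _ _ _).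
- exact: lin_comp (graft_mid_linear _ _ _ _ _ _) (bjoin_linearr _).
rewrite graft_last_basis graft_first_basis bjoin_basis -tree_ops_DotE.
exact: bilin_ext_basis.
Qed.

Lemma prec_vertex w B0 s x Bm (v : DT) :
  prec w (bs (Vertex B0 s x Bm)) v
  = graft_last B0 s x (bjoin (bs Bm) (edge w v)).
Proof. by rewrite -graft_last_basis prec_graft_last. Qed.

Lemma succ_vertex w (u : DT) C0 s y Cn :
  succ w u (bs (Vertex C0 s y Cn))
  = graft_first (bjoin (edge w u) (bs C0)) s y Cn.
Proof. by rewrite -graft_first_basis succ_graft_first. Qed.

Lemma dot_graft_last B0 s x (u : FB) C0 s' y Cn :
  dot (graft_last B0 s x u) (bs (Vertex C0 s' y Cn))
  = graft_mid B0 s x (bjoin u (bs C0)) s' y Cn.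
Proof. by rewrite -graft_first_basis dot_graft. Qed.

Lemma dot_graft_first B0 s x Bm (v : FB) s' y Cn :
  dot (bs (Vertex B0 s x Bm)) (graft_first v s' y Cn)
  = graft_mid B0 s x (bjoin (bs Bm) v) s' y Cn.
Proof. by rewrite -graft_last_basis dot_graft. Qed.

Lemma dot_vertex B0 s x Bm C0 s' y Cn :
  dot (bs (Vertex B0 s x Bm)) (bs (Vertex C0 s' y Cn))
  = graft_mid B0 s x (bjoin (bs Bm) (bs C0)) s' y Cn.
Proof. by rewrite -graft_last_basis dot_graft_last. Qed.

(** * The four identities that need no induction *)

(** The left operation changes only the first branch of the middle tree U, the right one only its
    last branch. Both sides are the same double sum, taken in opposite orders. The next three proofs
    follow this pattern. *)
Lemma succ_prec_basis a b T U V :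
  prec b (succ a (bs T) (bs U)) (bs V) = succ a (bs T) (prec b (bs U) (bs V)).
Proof.
case: U => C0 s y Cn.
rewrite succ_vertex prec_vertex /graft_first /graft_last.
rewrite (lin_lext _ _ (prec_linearl b (bs V))).
rewrite (lin_lext _ _ (succ_linearr a (bs T))).
under eq_lext do rewrite prec_vertex.
under [RHS]eq_lext do rewrite succ_vertex.
exact: lext_exchange.
Qed.

Lemma succ_dot_basis a T U V :
  dot (succ a (bs T) (bs U)) (bs V) = succ a (bs T) (dot (bs U) (bs V)).
Proof.
case: U V => [C0 s y Cn] [D0 s' z Dn].
rewrite succ_vertex dot_vertex /graft_first /graft_mid.
rewrite (lin_lext _ _ (dot_linearl (bs (Vertex D0 s' z Dn)))).
rewrite (lin_lext _ _ (succ_linearr a (bs T))).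
under eq_lext do rewrite dot_vertex.
under [RHS]eq_lext do rewrite succ_vertex.
exact: lext_exchange.
Qed.

Lemma dot_prec_basis a T U V :
  prec a (dot (bs T) (bs U)) (bs V) = dot (bs T) (prec a (bs U) (bs V)).
Proof.
case: T U => [B0 s x Bm] [C0 s' y Cn].
rewrite dot_vertex prec_vertex /graft_last /graft_mid.
rewrite (lin_lext _ _ (prec_linearl a (bs V))).
rewrite (lin_lext _ _ (dot_linearr (bs (Vertex B0 s x Bm)))).
under eq_lext do rewrite prec_vertex.
under [RHS]eq_lext do rewrite dot_vertex.
exact: lext_exchange.
Qed.

Lemma dot_dot_basis T U V :
  dot (dot (bs T) (bs U)) (bs V) = dot (bs T) (dot (bs U) (bs V)).
Proof.
case: T U V => [B0 s x Bm] [C0 s' y Cn] [D0 s'' z Dn].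
rewrite !dot_vertex /graft_mid.
rewrite (lin_lext _ _ (dot_linearl (bs (Vertex D0 s'' z Dn)))).
rewrite (lin_lext _ _ (dot_linearr (bs (Vertex B0 s x Bm)))).
under eq_lext do rewrite dot_vertex.
under [RHS]eq_lext do rewrite dot_vertex.
rewrite /graft_mid lext_exchange; apply: eq_lext => C; apply: eq_lext => B.
(* Both branches end up in the list of the merged vertex; the two sides bracket that list
   differently. *)
by rewrite -catA.
Qed.

(** * Associativity of the product of branches *)

Definition branch_assoc B C D : Prop :=
  bjoin (bjoin (bs B) (bs C)) (bs D) = bjoin (bs B) (bjoin (bs C) (bs D)).

(** Both sides graft at the last place of T: the left one (Bm U) V, the right one Bm (U V), products
    of branches being taken in [bjoin]. In the next two lemmas the product sits at the first place
    of V, then at the place where T and V are merged. *)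
Lemma prec_prec_vertex a b B0 s x Bm U V :
  branch_assoc Bm (Edge a U) (Edge b V) -> let T := Vertex B0 s x Bm in
  prec b (prec a (bs T) (bs U)) (bs V)
  = prec (a * b)%g (bs T) (dt_sum a b (bs U) (bs V)).
Proof.
move=> h /=; rewrite !prec_vertex prec_graft_last.
by rewrite -bjoin_edge !edge_basis h.
Qed.

Lemma succ_succ_vertex a b T U D0 s z Dn :
  branch_assoc (Edge a T) (Edge b U) D0 -> let V := Vertex D0 s z Dn in
  succ (a * b)%g (dt_sum a b (bs T) (bs U)) (bs V)
  = succ a (bs T) (succ b (bs U) (bs V)).
Proof.
move=> h /=; rewrite !succ_vertex succ_graft_first.
by rewrite -bjoin_edge !edge_basis h.
Qed.

Lemma prec_dot_vertex a B0 s x Bm U D0 s' z Dn :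
  branch_assoc Bm (Edge a U) D0 ->
  let T := Vertex B0 s x Bm in let V := Vertex D0 s' z Dn in
  dot (prec a (bs T) (bs U)) (bs V) = dot (bs T) (succ a (bs U) (bs V)).
Proof.
move=> h /=; rewrite prec_vertex succ_vertex dot_graft_last dot_graft_first.
by rewrite !edge_basis h.
Qed.

(* Only the first and the last branch count: these are the ones in which
   [tree_ops] recurses. *)
Fixpoint tsize T : nat :=
  let: Vertex B0 _ _ Bm := T in (bsize B0 + bsize Bm).+1
with bsize B : nat := if B is Edge _ T then tsize T else 0%N.

(** Induction on the total size. A leaf is a unit, so only three edges matter. The three identities
    [pp], [ss] and [pd] replace T, V or both by an outer branch, hence use associativity at a
    smaller size; the other four hold outright. *)
Lemma branch_joinA B C D : branch_assoc B C D.
Proof.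
have [n] := ubnP (bsize B + bsize C + bsize D).
elim: n => // n IH in B C D *.
case: B => [|a T]; first by rewrite /branch_assoc !bjoin_leafl.
case: C => [|b U]; first by rewrite /branch_assoc bjoin_leafl bjoin_leafr.
case: D => [|c V]; first by rewrite /branch_assoc !bjoin_leafr.
rewrite ltnS /= => le_n.
have pp : prec c (prec b (bs T) (bs U)) (bs V)
    = prec (b * c)%g (bs T) (dt_sum b c (bs U) (bs V)).
  case: T le_n => B0 s x Bm le_n; apply: prec_prec_vertex.
  by apply: IH => /=; rewrite /= in le_n; lia.
have ss : succ (a * b)%g (dt_sum a b (bs T) (bs U)) (bs V)
    = succ a (bs T) (succ b (bs U) (bs V)).
  case: V {pp} le_n => D0 s z Dn le_n; apply: succ_succ_vertex.
  by apply: IH => /=; rewrite /= in le_n; lia.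
have pd : dot (prec b (bs T) (bs U)) (bs V)
    = dot (bs T) (succ b (bs U) (bs V)).
  case: T V {pp ss} le_n => B0 s x Bm [D0 s' z Dn] le_n.
  by apply: prec_dot_vertex; apply: IH => /=; rewrite /= in le_n; lia.
(* The labels agree by associativity in [Omega]; what remains is an equation between the sums of
   trees carried by the edge. *)
rewrite /branch_assoc -!edge_basis !bjoin_edge mulgA; congr edge.
rewrite /(dt_sum (a * b)%g) /(dt_sum a (b * c)%g) ss -pp.
rewrite /dt_sum !(linD (prec_linearl _ _), linD (dot_linearl _)) /=.
rewrite pd succ_prec_basis succ_dot_basis dot_prec_basis dot_dot_basis.
rewrite !(linD (succ_linearr _ _), linD (dot_linearr _)) /=.
(* Seven terms on each side. The left side is grouped by its outer operation on V, the right side by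
   its outer operation on T. *)
by rewrite [LHS](AC (3*1*3) (1*(2*4*6)*(3*5*7))).
Qed.

(** * The axioms on all of [DT], by trilinearity *)

Lemma dt_trilin_eq (F G : DT -> DT -> DT -> DT) :
  (forall v w, linear (fun u => F u v w)) ->
  (forall v w, linear (fun u => G u v w)) ->
  (forall u w, linear (fun v => F u v w)) ->
  (forall u w, linear (fun v => G u v w)) ->
  (forall u v, linear (F u v)) -> (forall u v, linear (G u v)) ->
  (forall T U V, F (bs T) (bs U) (bs V) = G (bs T) (bs U) (bs V)) ->
  forall u v w, F u v w = G u v w.
Proof.
move=> F1 G1 F2 G2 F3 G3 FG u v w.
apply: (lin_ext_eq (F1 v w) (G1 v w)) => {u} T.
apply: (lin_ext_eq (F2 (bs T) w) (G2 (bs T) w)) => {v} U.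
exact: (lin_ext_eq (F3 (bs T) (bs U)) (G3 (bs T) (bs U))).
Qed.

Lemma dt_tridendriform : is_tridendriform_family prec succ dot.
Proof.
(* Used as rewriting rules, these settle the six linearity conditions of each application of
   [dt_trilin_eq]. *)
pose E := (prec_linearl, prec_linearr, succ_linearl, succ_linearr,
  dot_linearl, dot_linearr, dt_sum_linearl, dt_sum_linearr).
split.
- by move=> a; split=> u; [exact: prec_linearl|exact: prec_linearr].
- by move=> a; split=> u; [exact: succ_linearl|exact: succ_linearr].
- by split=> u; [exact: dot_linearl|exact: dot_linearr].
- move=> a b; apply: (dt_trilin_eq (F := fun u v w => prec b (prec a u v) w)
    (G := fun u v w => prec (a * b)%g u (dt_sum a b v w)))
    => [v w c u u'|v w c u u'|u w c v v'|u w c v v'|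
        u v c w w'|u v c w w'|T U V];
    rewrite ?E //.
  by case: T => B0 s x Bm; apply/prec_prec_vertex/branch_joinA.
- move=> a b; apply: (dt_trilin_eq (F := fun u v w => prec b (succ a u v) w)
    (G := fun u v w => succ a u (prec b v w)))
    => [v w c u u'|v w c u u'|u w c v v'|u w c v v'|
        u v c w w'|u v c w w'|T U V];
    rewrite ?E //; exact: succ_prec_basis.
- move=> a b; apply: (dt_trilin_eq
    (F := fun u v w => succ (a * b)%g (dt_sum a b u v) w)
    (G := fun u v w => succ a u (succ b v w)))
    => [v w c u u'|v w c u u'|u w c v v'|u w c v v'|
        u v c w w'|u v c w w'|T U V];
    rewrite ?E //.
  by case: V => D0 s z Dn; apply/succ_succ_vertex/branch_joinA.
- move=> a; apply: (dt_trilin_eq (F := fun u v w => dot (succ a u v) w)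
    (G := fun u v w => succ a u (dot v w)))
    => [v w c u u'|v w c u u'|u w c v v'|u w c v v'|
        u v c w w'|u v c w w'|T U V];
    rewrite ?E //; exact: succ_dot_basis.
- move=> a; apply: (dt_trilin_eq (F := fun u v w => dot (prec a u v) w)
    (G := fun u v w => dot u (succ a v w)))
    => [v w c u u'|v w c u u'|u w c v v'|u w c v v'|
        u v c w w'|u v c w w'|T U V];
    rewrite ?E //.
  by case: T V => B0 s x Bm [D0 s' z Dn]; apply/prec_dot_vertex/branch_joinA.
- move=> a; apply: (dt_trilin_eq (F := fun u v w => prec a (dot u v) w)
    (G := fun u v w => dot u (prec a v w)))
    => [v w c u u'|v w c u u'|u w c v v'|u w c v v'|
        u v c w w'|u v c w w'|T U V];
    rewrite ?E //; exact: dot_prec_basis.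
- apply: (dt_trilin_eq (F := fun u v w => dot (dot u v) w)
    (G := fun u v w => dot u (dot v w)))
    => [v w c u u'|v w c u u'|u w c v v'|u w c v v'|
        u v c w w'|u v c w w'|T U V];
    rewrite ?E //; exact: dot_dot_basis.
Qed.

End Trees.

(** * Induction over all branches of a vertex *)

Section StreeInduction.
Variables (X Omega : Type) (P : stree X Omega -> Prop).

Definition branch_all (B : branch X Omega) : Prop :=
  if B is Edge _ T then P T else True.

Fixpoint branches_all (s : seq (X * branch X Omega)) : Prop :=
  if s is p :: s' then branch_all p.2 /\ branches_all s' else True.

Hypothesis P_vertex : forall B0 s x Bm,
  branch_all B0 -> branches_all s -> branch_all Bm -> P (Vertex B0 s x Bm).

(** The inner [fix] provides the hypothesis for the branches stored in the list. Evaluation depends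
    on every branch, so an induction on [tsize], which sees only the outer two, would not reach
    them. *)
Fixpoint stree_nested_ind (T : stree X Omega) : P T :=
  let: Vertex B0 s x Bm := T in
  P_vertex x (branch_nested_ind B0)
    ((fix loop s : branches_all s :=
        if s is p :: s' then conj (branch_nested_ind p.2) (loop s') else I) s)
    (branch_nested_ind Bm)
with branch_nested_ind (B : branch X Omega) : branch_all B :=
  if B is Edge _ T then stree_nested_ind T else I.

End StreeInduction.

(** * Evaluation of trees in a tridendriform family algebra *)

Section Evaluation.
Variables (k : comPzRingType) (X : Type) (Omega : semigroupType).
Variables (M : lmodType k) (prec succ : Omega -> M -> M -> M).
Variables (dot : M -> M -> M) (f : X -> M).

Local Notation stree := (stree X Omega).
Local Notation branch := (branch X Omega).
Local Notation bs := (fm_basis k).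

Section Actions.
Variable g : stree -> M.

Definition lact (B : branch) (m : M) : M :=
  if B is Edge a T then succ a (g T) m else m.

Definition ract (m : M) (B : branch) : M :=
  if B is Edge a T then prec a m (g T) else m.

Definition spine (s : seq (X * branch)) (m : M) : M :=
  foldr (fun p m => dot (ract (f p.1) p.2) m) m s.

(** The values [g] of the subtrees are a parameter: the same formula defines [eval] and states the
    equation that every morphism satisfies. *)
Definition eval_step (B0 : branch) s x Bm : M :=
  lact B0 (spine s (ract (f x) Bm)).

End Actions.

Fixpoint eval (T : stree) : M :=
  let: Vertex B0 s x Bm := T in eval_step eval B0 s x Bm.

Lemma eval_unique (g : stree -> M) :
  (forall B0 s x Bm, g (Vertex B0 s x Bm) = eval_step g B0 s x Bm) ->
  g =1 eval.
Proof.
move=> gE; apply: stree_nested_ind => B0 s x Bm h0 hs hm.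
have lE m : lact g B0 m = lact eval B0 m by case: B0 h0 => //= a T ->.
have rE m B : branch_all (fun T => g T = eval T) B ->
    ract g m B = ract eval m B.
  by case: B => //= a T ->.
rewrite gE /= /eval_step lE rE //; congr lact.
by elim: s hs => //= -[y B] s IH [/= /rE -> /IH ->].
Qed.

Hypothesis H : is_tridendriform_family prec succ dot.

Let lprecl a v : linear (prec a ^~ v).
Proof. by have [] := tdf_prec_bilinear H a. Qed.
Let lprecr a u : linear (prec a u).
Proof. by have [] := tdf_prec_bilinear H a. Qed.
Let lsuccl a v : linear (succ a ^~ v).
Proof. by have [] := tdf_succ_bilinear H a. Qed.
Let lsuccr a u : linear (succ a u).
Proof. by have [] := tdf_succ_bilinear H a. Qed.
Let ldotl v : linear (dot ^~ v).
Proof. by have [] := tdf_dot_bilinear H. Qed.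
Let ldotr u : linear (dot u).
Proof. by have [] := tdf_dot_bilinear H. Qed.

Lemma lact_linear g B : linear (lact g B).
Proof. by case: B => [|a T] //; exact: lsuccr. Qed.

Lemma spine_linear g s : linear (spine g s).
Proof.
elim: s => //= p s IH.
exact: (lin_comp (ldotr _) IH).
Qed.

Lemma prec_lact g B a m n : prec a (lact g B m) n = lact g B (prec a m n).
Proof. by case: B => //= b T; rewrite (tdf_succ_prec H). Qed.

Lemma dot_lact g B m n : dot (lact g B m) n = lact g B (dot m n).
Proof. by case: B => //= b T; rewrite (tdf_succ_dot H). Qed.

(** The action is balanced: a branch between two factors of a dot product may act on either of
    them. *)
Lemma dot_ract g B m n : dot (ract g m B) n = dot m (lact g B n).
Proof. by case: B => //= b T; rewrite (tdf_prec_dot H). Qed.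

Lemma prec_spine g s a m n : prec a (spine g s m) n = spine g s (prec a m n).
Proof. by elim: s => //= p s IH; rewrite (tdf_dot_prec H) IH. Qed.

Lemma dot_spine g s m n : dot (spine g s m) n = spine g s (dot m n).
Proof. by elim: s => //= p s IH; rewrite (tdf_dot_dot H) IH. Qed.

Definition lactL (u : freemod k branch) m := lext (fun B => lact eval B m) u.
Definition ractL m (u : freemod k branch) := lext (fun B => ract eval m B) u.

Local Notation G := (lext eval : DT k X Omega -> M).

Lemma lext_eval_graft_last B0 s x u :
  G (graft_last B0 s x u) = lact eval B0 (spine eval s (ractL (f x) u)).
Proof.
rewrite /graft_last /ractL (lin_lext _ _ (@spine_linear eval s)).
rewrite (lin_lext _ _ (@lact_linear eval B0)).
rewrite (lin_lext (M := DT k X Omega) _ _ (lext_linear eval)).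
by apply: eq_lext => B; rewrite lext_basis.
Qed.

Lemma lext_eval_graft_first u s x Bm :
  G (graft_first u s x Bm) = lactL u (spine eval s (ract eval (f x) Bm)).
Proof.
rewrite /graft_first /lactL.
rewrite (lin_lext (M := DT k X Omega) _ _ (lext_linear eval)).
by apply: eq_lext => B; rewrite lext_basis.
Qed.

Lemma lext_eval_graft_mid B0 s x u s' y Bn :
  G (graft_mid B0 s x u s' y Bn) = lact eval B0 (spine eval s
    (dot (ractL (f x) u) (spine eval s' (ract eval (f y) Bn)))).
Proof.
rewrite /graft_mid /ractL (lin_lext _ _ (@ldotl _)).
rewrite (lin_lext _ _ (@spine_linear eval s)).
rewrite (lin_lext _ _ (@lact_linear eval B0)).
rewrite (lin_lext (M := DT k X Omega) _ _ (lext_linear eval)).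
apply: eq_lext => B; rewrite lext_basis /= /eval_step.
by rewrite /spine foldr_cat.
Qed.

Definition eval_op (o : tree_op Omega) : M -> M -> M :=
  match o with Prec a => prec a | Succ a => succ a | Defs.Dot => dot end.

Lemma lactL_edge_join a b F m : lactL (edge_join a b F) m
  = succ (a * b)%g (G (F (Succ a)) + G (F (Prec b)) + G (F (Defs.Dot _))) m.
Proof.
rewrite -!(linD (lext_linear eval)) /edge_join /lactL.
rewrite (lin_lext _ _ (@lsuccl _ _)).
rewrite (lin_lext _ _ (lext_linear (fun B => lact eval B m))).
by apply: eq_lext => T; rewrite lext_basis.
Qed.

Lemma ractL_edge_join a b F m : ractL m (edge_join a b F)
  = prec (a * b)%g m (G (F (Succ a)) + G (F (Prec b)) + G (F (Defs.Dot _))).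
Proof.
rewrite -!(linD (lext_linear eval)) /edge_join /ractL.
rewrite (lin_lext _ _ (@lprecr _ _)).
rewrite (lin_lext _ _ (lext_linear (fun B => ract eval m B))).
by apply: eq_lext => T; rewrite lext_basis.
Qed.

(** Compatibility of both actions with the product of branches: acting by a product is acting by the
    factors in succession. *)
Definition branch_join_acts B C : Prop :=
  (forall m, lactL (branch_join k B C) m = lact eval B (lact eval C m)) /\
  (forall m, ractL m (branch_join k B C) = ract eval (ract eval m B) C).

(** Each operation joins a single pair of branches, smaller in total than T and U because a vertex
    is removed. The hypothesis splits the action of that product, and the axioms then move the
    operation past [lact] and [spine]. *)
Lemma eval_tree_ops_rec T U o :
  (forall B C, (bsize B + bsize C < tsize T + tsize U)%N ->
    branch_join_acts B C) ->
  G (tree_ops k T U o) = eval_op o (eval T) (eval U).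
Proof.
case: o => [w|w|].
- case: T => B0 s x Bm acts; rewrite tree_ops_PrecE lext_eval_graft_last.
  by rewrite (acts _ _ _).2 /= ?prec_lact ?prec_spine //; lia.
- case: U => C0 s y Cn acts; rewrite tree_ops_SuccE lext_eval_graft_first.
  by rewrite (acts _ _ _).1 //=; lia.
case: T U => [B0 s x Bm] [C0 s' y Cn] acts.
rewrite tree_ops_DotE lext_eval_graft_mid (acts _ _ _).2 /=; last by lia.
by rewrite /eval_step dot_lact dot_spine !dot_ract.
Qed.

(** For two edges the product carries the three operations on their trees, which [eval_tree_ops_rec]
    evaluates from smaller pairs. The first and third axioms then turn the action of the sum into
    two successive actions. *)
Lemma branch_join_actsP B C : branch_join_acts B C.
Proof.
have [n] := ubnP (bsize B + bsize C); elim: n => // n IH in B C *.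
case: B => [|a T]; first by split=> m; rewrite /lactL /ractL lext_basis.
case: C => [|b U]; first by split=> m; rewrite /lactL /ractL lext_basis.
rewrite ltnS => le_n.
have GE o : G (tree_ops k T U o) = eval_op o (eval T) (eval U).
  by apply: eval_tree_ops_rec => B C lt; apply: IH; apply: leq_trans le_n.
split=> m; rewrite ?lactL_edge_join ?ractL_edge_join !GE /=.
  by rewrite (addrC (succ _ _ _)) (tdf_succ_succ H).
by rewrite (addrC (succ _ _ _)) (tdf_prec_prec H).
Qed.

Lemma eval_bilin_ext o (u v : DT k X Omega) :
  G (bilin_ext (fun T U => tree_ops k T U o) u v) = eval_op o (G u) (G v).
Proof.
have lG := lext_linear (k := k) eval.
have lop m : linear (fun n => eval_op o n m).
  by case: (o) => [a|a|]; [exact: lprecl|exact: lsuccl|exact: ldotl].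
have rop m : linear (eval_op o m).
  by case: (o) => [a|a|]; [exact: lprecr|exact: lsuccr|exact: ldotr].
apply: (lin_ext_eq
  (f := fun u => G (bilin_ext (fun T U => tree_ops k T U o) u v))
  (g := fun u => eval_op o (G u) (G v))) => {u}[||T].
- exact: lin_comp lG (bilin_ext_linearl _ _).
- exact: lin_comp (lop _) lG.
apply: (lin_ext_eq
  (f := fun v => G (bilin_ext (fun T U => tree_ops k T U o) (fm_basis k T) v))
  (g := fun v => eval_op o (G (bs T)) (G v))) => {v}[||U].
- exact: lin_comp lG (bilin_ext_linearr _ _).
- exact: lin_comp (rop _) lG.
rewrite bilin_ext_basis !lext_basis.
by apply: eval_tree_ops_rec => B C _; exact: branch_join_actsP.
Qed.

Lemma lext_eval_morphism : is_tridendriform_morphism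
  (@dt_prec k X Omega) (@dt_succ k X Omega) (@dt_dot k X Omega)
  prec succ dot G.
Proof.
split=> [|a u v|a u v|u v]; first exact: lext_linear.
- exact: (eval_bilin_ext (Prec a)).
- exact: (eval_bilin_ext (Succ a)).
- exact: (eval_bilin_ext (Defs.Dot _)).
Qed.

(** The generators produce every tree: a last branch is attached to [dt_j] by [prec], vertices with
    first branch [Leaf] are concatenated by [dot], and a first branch is attached by [succ]. A
    morphism follows this construction. *)
Lemma morphism_eval_step (g : DT k X Omega -> M) :
  is_tridendriform_morphism
    (@dt_prec k X Omega) (@dt_succ k X Omega) (@dt_dot k X Omega)
    prec succ dot g ->
  (forall x, g (dt_j k Omega x) = f x) ->
  forall B0 s x Bm, g (bs (Vertex B0 s x Bm))
    = eval_step (fun T => g (bs T)) B0 s x Bm.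
Proof.
move=> [_ gprec gsucc gdot] gj B0 s x Bm.
pose h T := g (bs T).
have hlast y B : g (bs (Vertex Leaf [::] y B)) = ract h (f y) B.
  rewrite -gj; case: B => //= a T; rewrite -gprec.
  by rewrite prec_vertex edge_basis bjoin_leafl graft_last_basis.
transitivity (lact h B0 (g (bs (Vertex Leaf s x Bm)))).
  case: B0 => //= a T; rewrite -gsucc.
  by rewrite succ_vertex edge_basis bjoin_leafr graft_first_basis.
congr lact; elim: s => [|[y B] s IH] /=; first exact: hlast.
rewrite -IH -hlast -gdot.
by rewrite dot_vertex bjoin_leafr graft_mid_basis.
Qed.

End Evaluation.

(** * Existence and uniqueness of the extension to [DT] *)

Theorem theorem4p10 (k : comPzRingType) (X : Type) (Omega : semigroupType) :
  is_tridendriform_family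
    (@dt_prec k X Omega) (@dt_succ k X Omega) (@dt_dot k X Omega) /\
  (forall (T' : lmodType k)
          (prec' succ' : Omega -> T' -> T' -> T') (dot' : T' -> T' -> T'),
    is_tridendriform_family prec' succ' dot' ->
    forall f : X -> T',
    exists! g : DT k X Omega -> T',
      is_tridendriform_morphism
        (@dt_prec k X Omega) (@dt_succ k X Omega) (@dt_dot k X Omega)
        prec' succ' dot' g /\
      f = g \o @dt_j k X Omega).
Proof.
split; first exact: dt_tridendriform.
move=> M prec succ dot H f.
exists (lext (eval prec succ dot f)); split; first split.
- exact: lext_eval_morphism.
- by apply: funext => x /=; rewrite lext_basis.
move=> g [g_mor fE]; apply: funext => u.
(* Two linear maps are compared on single trees, where [g] satisfies the recursion that determines
   [eval]. *)
apply: (lin_ext_eq (lext_linear _) (tdm_linear g_mor)) => T.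
rewrite lext_basis; symmetry; move: T.
apply: (eval_unique (g := fun T => g (fm_basis k T))).
apply: morphism_eval_step g_mor _ => x; by rewrite fE.
Qed.
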